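(* Let $Y$ be the poset of all integer partitions, ordered by containment of Ferrers diagrams, and let $\mathcal{C}\subseteq Y$ be a downset. Then $\mathcal{C}$ (with the induced order) is finite dimensional if and only if $\mathcal{C}\neq Y$, that is, if and only if $\mathcal{C}$ does not contain every partition.
   Context: An integer partition is a finite weakly decreasing sequence $\lambda_1\ge\lambda_2\ge\cdots\ge\lambda_k$ of positive integers (the empty partition is allowed). Containment of Ferrers diagrams (Young's lattice): $\lambda\le\mu$ if and only if $\lambda_i\le\mu_i$ for all $i$, where missing parts are taken to be $0$. A downset of a poset $P$ is a subset $\mathcal{C}\subseteq P$ such that $y\in\mathcal{C}$ and $x\le y$ imply $x\in\mathcal{C}$. The (Dushnik–Miller) dimension of a poset $P$ is the least $d$ such that $P$ embeds into a product of $d$ linear orders (with the componentwise order), where an embedding is a map $f$ with $x\le y\iff f(x)\le f(y)$. A poset is finite dimensional if such a finite $d$ exists, and infinite dimensional otherwise. *)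

(* Defs.v *)
From HB Require Import structures.
From mathcomp Require Import all_boot all_order.
From mathcomp Require Import boolp classical_sets.

Set Implicit Arguments.
Unset Strict Implicit.
Unset Printing Implicit Defensive.

Import Order.TTheory.

Local Open Scope order_scope.
Local Open Scope classical_set_scope.

Definition is_int_partition (s : seq nat) : bool :=
  sorted geq s && all (fun k => 0 < k)%N s.

Record int_partition := IntPartition {
  parts :> seq nat;
  partsP : is_int_partition parts
}.

HB.instance Definition _ := [isSub for parts].
HB.instance Definition _ := [Choice of int_partition by <:].

(* In mathematical indexing this is the part numbered i + 1; parts beyond the
   length are 0. *)
Definition part (l : int_partition) (i : nat) : nat := nth 0%N l i.

(* The quantification over all i is cut down to i < size l to get a boolean;
   the remaining i are harmless since then part l i = 0 (lemma
   int_partition_leP below). *)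
Definition int_partition_le (l m : int_partition) : bool :=
  all (fun i => (part l i <= part m i)%N) (iota 0 (size l)).

Lemma int_partition_leP (l m : int_partition) :
  reflect (forall i, (part l i <= part m i)%N) (int_partition_le l m).
Proof.
apply: (iffP allP) => [H i|H i _]; last exact: H.
have [li|li] := ltnP i (size l); first by apply: H; rewrite mem_iota.
by rewrite /part nth_default.
Qed.

Fact int_partition_le_refl : reflexive int_partition_le.
Proof. by move=> l; apply/int_partition_leP. Qed.

Fact int_partition_le_trans : transitive int_partition_le.
Proof.
move=> m l n /int_partition_leP lm /int_partition_leP mn.
apply/int_partition_leP => i; exact: leq_trans (lm i) (mn i).
Qed.

Fact int_partition_le_anti : antisymmetric int_partition_le.
Proof.
have part_gt0 (l : int_partition) i : (0 < part l i)%N = (i < size l)%N.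
  have [li|li] := ltnP i (size l); last by rewrite /part nth_default.
  by case/andP: (partsP l) => _ /allP; apply; exact: mem_nth.
move=> l m /andP[/int_partition_leP lm /int_partition_leP ml].
have e i : part l i = part m i by apply/eqP; rewrite eqn_leq lm ml.
have szE : size l = size m.
  apply/eqP; rewrite eqn_leq leqNgt -part_gt0 e part_gt0 ltnn /=.
  by rewrite leqNgt -part_gt0 -e part_gt0 ltnn.
by apply/val_inj/(@eq_from_nth _ 0%N) => // i _; exact: e.
Qed.

Fact int_partition_display : Order.disp_t. Proof. exact: Order.Disp tt tt. Qed.

HB.instance Definition _ :=
  Order.Le_isPOrder.Build int_partition_display int_partition
    int_partition_le_refl int_partition_le_anti int_partition_le_trans.

Definition downset disp (P : porderType disp) (C : set P) : Prop :=
  forall x y : P, C y -> x <= y -> C x.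

(* The induced order on a subset C : set P, seen as the type set_type C. *)
HB.instance Definition _ disp (P : porderType disp) (C : set P) :=
  SubChoice.copy (set_type C) {x : P | x \in C}.
HB.instance Definition _ disp (P : porderType disp) (C : set P) :=
  [SubChoice_isSubPOrder of set_type C by <: with disp].

(* The linear orders may differ from one coordinate to the next; the display
   only selects notations and carries no content. *)
Definition embeds_in_chains disp (P : porderType disp) (d : nat) : Prop :=
  exists (disp' : Order.disp_t) (L : 'I_d -> orderType disp')
         (f : P -> forall i : 'I_d, L i),
    forall x y : P, x <= y <-> forall i : 'I_d, f x i <= f y i.

Definition has_dimension disp (P : porderType disp) (d : nat) : Prop :=
  embeds_in_chains P d /\ forall d', embeds_in_chains P d' -> (d <= d')%N.

Definition finite_dimensional disp (P : porderType disp) : Prop :=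
  exists d, has_dimension P d.

(* Main.v *)
Require Import Defs.
From mathcomp Require Import all_boot all_order.
From mathcomp Require Import boolp classical_sets.

(** Both directions rest on elementary pictures of Ferrers diagrams.

    If [C] contains every partition, it contains every standard example.
    Take a staircase with [n] rows: adding a cell at the end of any set of rows
    still gives a partition, so the Boolean lattice on [n] atoms sits inside
    the poset.  Its atoms and coatoms form the standard example of size [n],
    and this needs [n] chains: a chain that witnesses that the [i]-th atom is
    not below the [i]-th coatom cannot do so for another index
    ([standard_example_dim_ge]).

    If [C] misses a partition [mu], pick [k] at least the number of rows and
    of columns of [mu].  A diagram that contains the cell [(k, k)] contains
    all of [mu], hence no diagram in the downset [C] contains that cell
    ([downset_part_le]).  Such a diagram is a union of [k] rows and [k]
    columns, and comparing these [2 k] lengths decides containment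
    ([hook_shape_leP]), which embeds [C] into [2 k] copies of the chain of
    natural numbers. *)

Import Order.TTheory.

Local Open Scope classical_set_scope.

(** * Dimension *)

Lemma finite_dimensionalP disp (P : porderType disp) :
  finite_dimensional P <-> exists d, embeds_in_chains P d.
Proof.
split=> [[d [Pd _]]|[d Pd]]; first by exists d.
have exP : exists d, `[< embeds_in_chains P d >] by exists d; apply/asboolP.
case: (ex_minnP exP) => m /asboolP Pm m_min.
by exists m; split=> // d' Pd'; apply/m_min/asboolP.
Qed.

(** Choose for each [i] a coordinate that separates [a i] from [b i].  If [i]
    and [j] shared a coordinate, then
    [b i < a i <= b j < a j <= b i] would hold there; so the choice is
    injective. *)
Lemma standard_example_dim_ge disp (P : porderType disp) (n d : nat)
    (a b : 'I_n -> P) :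
  (forall i j, (a i <= b j)%O = (i != j)) -> embeds_in_chains P d -> n <= d.
Proof.
move=> ab [disp' [L [f fP]]].
have sep i : exists c : 'I_d, (f (b i) c < f (a i) c)%O.
  apply: contrapT => /forallNP nlt.
  have /fP : forall c, (f (a i) c <= f (b i) c)%O.
    by move=> c; rewrite leNgt; apply/negP/nlt.
  by rewrite ab eqxx.
have [c cP] := fin_all_exists sep.
suff /leq_card : injective c by rewrite !card_ord.
move=> i j cij; apply/eqP/negPn/negP => nij.
have /fP/(_ (c i)) aibj : (a i <= b j)%O by rewrite ab.
have /fP/(_ (c i)) ajbi : (a j <= b i)%O by rewrite ab eq_sym.
have := cP j; rewrite -cij => bjaj.
have := lt_le_trans (le_lt_trans aibj bjaj) ajbi.
by rewrite lt_gtF.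
Qed.

(** * The staircase with extra cells *)

Definition staircase_parts (n : nat) (S : pred nat) : seq nat :=
  mkseq (fun i => n - i + S i) n.

Lemma staircase_partsP n S : is_int_partition (staircase_parts n S).
Proof.
apply/andP; split; last first.
  apply/allP => x /mapP[i]; rewrite mem_iota => /= lin ->.
  by rewrite addn_gt0 subn_gt0 lin.
apply/(sortedP 0) => i; rewrite size_mkseq => lin.
rewrite !nth_mkseq //; last exact: ltnW.
(* The base drops by one from row to row, which absorbs one extra cell. *)
apply: (@leq_trans (n - i.+1 + 1)); first by rewrite leq_add2l leq_b1.
by rewrite addn1 subnSK ?leq_addr // ltnW.
Qed.

Definition staircase n S : int_partition := IntPartition (staircase_partsP n S).

Lemma staircase_leP n (S T : pred nat) :
  reflect (forall i, i < n -> S i -> T i) (staircase n S <= staircase n T)%O.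
Proof.
apply: (iffP (int_partition_leP _ _)) => [ST i lin Si|ST i].
  move: (ST i); rewrite /part /= !nth_mkseq // leq_add2l Si.
  by case: (T i).
have [lin|nli] := ltnP i n; last by rewrite /part nth_default ?size_mkseq.
rewrite /part /= !nth_mkseq // leq_add2l.
by have := ST i lin; case: (S i) => // ->.
Qed.

Lemma staircase_standard_example n (i j : 'I_n) :
  (staircase n (pred1 (i : nat)) <= staircase n (predC1 (j : nat)))%O
  = (i != j).
Proof.
apply/staircase_leP/idP => [/(_ i (ltn_ord i) (eqxx _)) //|nij k _ /eqP ->].
exact: nij.
Qed.

(** * Rows and columns of a diagram *)

(** The length of column [j], that is, part [j] of the conjugate partition. *)
Definition column (l : int_partition) (j : nat) : nat := count (ltn j) l.

(** Both sides say that the cell [(i, j)] lies in the diagram. *)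
Lemma ltn_part_column l i j : (j < part l i) = (i < column l j).
Proof.
rewrite /part /column; have /andP[+ _] := partsP l.
elim: {l}(parts l) i => [|x s IHs] i /=; first by rewrite nth_nil.
move=> xs; have s_sorted := path_sorted xs.
have [ltjx|lexj] := ltnP j x; first by case: i => [|i] //=; rewrite IHs.
have s_le : all (geq x) s.
  by apply: order_path_min xs => y z t zy yt; exact: leq_trans yt zy.
have /eqP -> : count (ltn j) s == 0.
  rewrite -leqn0 leqNgt -has_count; apply/hasPn => y /(allP s_le) leyx.
  by rewrite /= -leqNgt (leq_trans leyx).
apply/negbTE; rewrite -leqNgt; case: i => [|i] //=.
have [lis|nlis] := ltnP i (size s); last by rewrite nth_default.
exact: leq_trans (allP s_le _ (mem_nth _ lis)) lexj.
Qed.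

Lemma part_antitone l i j : i <= j -> part l j <= part l i.
Proof.
move=> leij; rewrite leqNgt; apply/negP.
rewrite ltn_part_column => /(leq_ltn_trans leij).
by rewrite -ltn_part_column ltnn.
Qed.

(** A cell of [l] outside the first [k] rows lies in the first [k] columns,
    because the cell [(k, k)] is missing. *)
Lemma hook_shape_leP k (l m : int_partition) : part l k <= k ->
  (l <= m)%O <->
  (forall i, i < k -> part l i <= part m i /\ column l i <= column m i).
Proof.
move=> lk; split=> [/int_partition_leP lm i _|lm].
  split=> //; rewrite leqNgt; apply/negP; rewrite -ltn_part_column.
  by move=> /leq_trans /(_ (lm _)); rewrite ltn_part_column ltnn.
apply/int_partition_leP => i; have [/lm[]//|leki] := ltnP i k.
rewrite leqNgt; apply/negP => mli.
have /lm[_ cols] : part m i < k.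
  exact: (leq_trans mli (leq_trans (part_antitone _ _ _ leki) lk)).
move: mli; rewrite ltn_part_column => /leq_trans /(_ cols).
by rewrite -ltn_part_column ltnn.
Qed.

Lemma downset_part_le (C : set int_partition) :
  downset C -> C <> [set: int_partition] ->
  exists k, forall l, C l -> part l k <= k.
Proof.
move=> hC nCT; have [mu nCmu] : exists mu, ~ C mu.
  by apply/existsNP => allC; apply/nCT/seteqP; split.
exists (size mu + part mu 0) => l Cl; set k := size mu + part mu 0.
rewrite leqNgt; apply/negP => ltkl; apply/nCmu/(hC _ l Cl)/int_partition_leP => i.
have [lik|nlis] := ltnP i (size mu); last by rewrite /part nth_default.
apply: leq_trans (part_antitone mu _ _ (leq0n i)) (leq_trans (leq_addl (size mu) _) _).
apply: leq_trans (ltnW ltkl) (part_antitone l _ _ _).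
exact: leq_trans (ltnW lik) (leq_addr _ _).
Qed.

Lemma embeds_in_rows_and_columns (C : set int_partition) k :
  (forall l, C l -> part l k <= k) -> embeds_in_chains (set_type C) (k + k).
Proof.
move=> Ck; exists _, (fun=> nat : orderType _).
exists (fun l c => match split c with
                   | inl i => part (\val l) i
                   | inr j => column (\val l) j
                   end) => l m.
have lk : part (\val l) k <= k by apply/Ck/set_mem/(valP l).
rewrite -[(l <= m)%O]Order.le_val; split.
  move=> /(hook_shape_leP k _ _ lk) lm c.
  by case: (split c) => i; have [] := lm i (ltn_ord i).
move=> lm; apply/(hook_shape_leP k _ _ lk) => i lik; split.
- by have := lm (unsplit (inl (Ordinal lik))); rewrite unsplitK.
- by have := lm (unsplit (inr (Ordinal lik))); rewrite unsplitK.
Qed.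

(** * The dichotomy *)

Theorem theorem1p1 (C : set int_partition) (hC : downset C) :
  finite_dimensional (set_type C) <-> C <> [set: int_partition].
Proof.
rewrite finite_dimensionalP; split=> [[d Cd] CT|CT].
- have inC l : l \in C by rewrite CT; apply/mem_set.
  pose inj l : set_type C := exist _ l (inC l).
  pose a (i : 'I_d.+1) := inj (staircase d.+1 (pred1 (i : nat))).
  pose b (i : 'I_d.+1) := inj (staircase d.+1 (predC1 (i : nat))).
  suff ab i j : (a i <= b j)%O = (i != j).
    by have := standard_example_dim_ge _ _ _ _ _ _ ab Cd; rewrite ltnn.
  by rewrite -Order.le_val; exact: staircase_standard_example.
- have [k Ck] := downset_part_le _ hC CT.
  by exists (k + k); exact: embeds_in_rows_and_columns.
Qed.
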